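(* Let $(W\rightrightarrows W_N;H\rightrightarrows N)$ and $(V\rightrightarrows V_M;G\rightrightarrows M)$ be VBGs, let $C$ be the core of $V$, and let $F, F'\colon W\to V$ be VBG morphisms covering the same Lie groupoid morphism $f\colon (H\rightrightarrows N)\to (G\rightrightarrows M)$. Let $(T,f)\colon (W_N\to N)\to (V\to G)$ be a VB morphism (covering $f\colon N\to M\subseteq G$) with $s\circ T=F$ on $W_N$, and let $\mathcal{H}_T \colon W_N \to C$ be the VB morphism covering $f\colon N\to M$ defined by $\mathcal{H}_T(w)= T(w)-F(w)$, $w\in W_N$ (where $F(w)\in V_M$ is identified with its unit in $V$). The following conditions are equivalent: i) $(T,f)\colon (F,f)\Rightarrow (F',f)$ is a linear natural isomorphism; ii) $F'$ is homotopic to $F$ through $\mathcal{H}_T$; iii) for any $y\in N$, $\mathcal{H}_T\colon W_{N,y}\to C_{f(y)}$ is a homotopy between the cochain maps on the fibres over $y$ and $f(y)$ induced by $F,F'$, i.e. $\mathcal H_T\circ t|_D=F'-F$ on $D_y$ and $t|_C\circ\mathcal H_T=F'-F$ on $W_{N,y}$, where $D$ is the core of $W$; and additionally, for any $\omega\in W_h$, $h\in H$, $$(F'-F)(\omega)\cdot \mathcal{H}_T\big(s(\omega)\big)= \mathcal H_T\big(t(\omega)\big)\cdot 0_{f(h)}^V.$$ Moreover the assignment $(T, f) \mapsto \mathcal{H}_T$ establishes a bijection between linear natural isomorphisms $(T, f)$ from $F$ to $F'$ and VB morphisms from $W_N$ to $C$ covering $f$ that make $F'$ homotopic to $F$.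
   Context: For a Lie groupoid write $s,t$ for source and target; $gh$ is defined when $s(g)=t(h)$; objects are identified with units. A VB-groupoid (VBG) $(V\rightrightarrows V_M;G\rightrightarrows M)$ consists of Lie groupoids $V\rightrightarrows V_M$, $G\rightrightarrows M$ and vector bundles $V\to G$, $V_M\to M$ such that all structure maps of $V$ are vector bundle (VB) morphisms covering those of $G$; its core is the VB $C=\ker(s\colon V\to V_M)|_M$ over $M$, with core-anchor $t|_C\colon C\to V_M$. The fibre of $V$ over $x\in M$ is the complex $0\to C_x\xrightarrow{t|_C}V_{M,x}\to0$. $0^V_g$ denotes the zero vector of $V_g$. A VBG morphism $(F,f)$ consists of Lie groupoid morphisms $F\colon(W\rightrightarrows W_N)\to(V\rightrightarrows V_M)$, $f\colon(H\rightrightarrows N)\to(G\rightrightarrows M)$ (same letter on arrows and objects) with $F$ a VB morphism over $f$ on arrows and on objects; it induces, for each $y\in N$, a cochain map from the fibre of $W$ over $y$ to the fibre of $V$ over $f(y)$. A linear natural isomorphism $(T,\tau)\colon(F,f)\Rightarrow(F',f')$ between VBG morphisms is a VB morphism $(T,\tau)\colon(W_N\to N)\to(V\to G)$ such that $T\colon F\Rightarrow F'$ is a natural isomorphism, i.e. $T(w)$ is an arrow from $F(w)$ to $F'(w)$ and $F'(\omega)\,T(s(\omega))=T(t(\omega))\,F(\omega)$ for all $\omega\in W$. Given a VB morphism $\mathcal H\colon W_N\to C$ covering $f\colon N\to M$, let $J_{\mathcal H}\colon W\to V$ be the VBG morphism covering $f$ given by $J_{\mathcal H}(\omega)=0^V_{f(h)}\cdot\mathcal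 H(s(\omega))^{-1}+\mathcal H(t(\omega))\cdot0^V_{f(h)}$ for $\omega\in W_h$, and $J_{\mathcal H}(w)=t(\mathcal H(w))$ for $w\in W_N$. For VBG morphisms $F,F'\colon W\to V$ covering the same $f$, $F'$ is homotopic to $F$ through $\mathcal H$ if $F'-F=J_{\mathcal H}$. *)

(* Defs.v *)
From mathcomp Require Import all_boot all_order all_algebra.
From mathcomp Require Import all_classical all_reals all_analysis.

Set Implicit Arguments.
Unset Strict Implicit.
Unset Printing Implicit Defensive.

Import Order.TTheory GRing.Theory Num.Theory.
Import numFieldNormedType.Exports.

Local Open Scope classical_set_scope.
Local Open Scope ring_scope.

(* Used below only for open [U] in finite-dimensional spaces, where this is the
   usual notion of a map of class C^k on [U]. *)
Fixpoint Ck (R : realType) (V W : normedModType R) (k : nat)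
    (U : set V) (f : V -> W) : Prop :=
  if k is k'.+1 then
    (forall x, U x -> differentiable f x) /\
    (forall v : V, Ck k' U (fun x => 'D_v f x : W))
  else forall x, U x -> {for x, continuous f}.

Definition Cinf (R : realType) (V W : normedModType R)
    (U : set V) (f : V -> W) : Prop := forall k, Ck k U f.

Record chart (R : realType) (T : Type) (n : nat) := Chart {
  cdom : set T;
  cmap : T -> 'rV[R]_n  (* only relevant on cdom *)
}.

(* A topological space with a set of candidate charts; the axioms of a manifold
   are imposed in [is_manifold]. *)
Record charted (R : realType) := Charted {
  cspace :> topologicalType;
  cdim : nat;
  catlas : set (chart R cspace cdim)
}.
Arguments catlas {R} _ _.

(* [c] is a homeomorphism from an open set onto an open subset of R^n. *)
Definition is_chart (R : realType) (T : topologicalType) n (c : chart R T n) :=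
  [/\ open (cdom c),
      forall x y, cdom c x -> cdom c y -> cmap c x = cmap c y -> x = y,
      forall O, open O -> open (cdom c `&` cmap c @^-1` O)
    & forall U, U `<=` cdom c -> open U -> open (cmap c @` U)].

(* The transition map [cmap d \o (cmap c)^-1] is smooth. *)
Definition chart_compat (R : realType) (T : topologicalType) n
    (c d : chart R T n) :=
  exists2 g : 'rV[R]_n -> 'rV[R]_n,
    Cinf (cmap c @` (cdom c `&` cdom d)) g &
    forall x, cdom c x -> cdom d x -> g (cmap c x) = cmap d x.

Definition is_manifold (R : realType) (M : charted R) : Prop :=
  [/\ hausdorff_space M,
      @second_countable M,
      forall c, catlas M c -> is_chart c,
      forall x : M, exists2 c, catlas M c & cdom c x
    & forall c d, catlas M c -> catlas M d -> chart_compat c d].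

Record manifold (R : realType) := Manifold {
  mspace :> charted R;
  manifoldP : is_manifold mspace
}.

Definition euclid (R : realType) (n : nat) : charted R :=
  @Charted R ('rV[R]_n : topologicalType) n [set Chart setT id].

Definition prod_chart (R : realType) (S T : Type) m n
    (c : chart R S m) (d : chart R T n) : chart R (S * T) (m + n) :=
  Chart (cdom c `*` cdom d) (fun p => row_mx (cmap c p.1) (cmap d p.2)).

Definition prod_charted (R : realType) (M N : charted R) : charted R :=
  @Charted R ((M * N)%type : topologicalType) (cdim M + cdim N)
    [set e | exists c d, [/\ catlas M c, catlas N d & e = prod_chart c d]].

(* On the part of [A] lying over the open set [O], the map [f] reads [g] in the
   charts [c] and [d]. *)
Definition coord_rep (R : realType) (M N : charted R) (A : set M) (f : M -> N)
    (c : chart R M (cdim M)) (d : chart R N (cdim N))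
    (O : set 'rV[R]_(cdim M)) (g : 'rV[R]_(cdim M) -> 'rV[R]_(cdim N)) :=
  [/\ open O, Cinf O g &
      forall x, A x -> cdom c x -> O (cmap c x) ->
        cdom d (f x) /\ cmap d (f x) = g (cmap c x)].

(* Smoothness on a subset is local extendability to smooth maps on open sets.
   For [A] open or [A] an embedded submanifold this is the usual notion. *)
Definition smooth_on (R : realType) (M N : charted R) (A : set M)
    (f : M -> N) : Prop :=
  forall x, A x -> exists c d O g,
    [/\ catlas M c /\ cdom c x, catlas N d /\ cdom d (f x),
        O (cmap c x) & coord_rep A f c d O g].

Definition smooth (R : realType) (M N : charted R) (f : M -> N) : Prop :=
  smooth_on setT f.

Definition submersion (R : realType) (M N : charted R) (f : M -> N) : Prop :=
  forall x, exists c d O g,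
    [/\ [/\ catlas M c, cdom c x, catlas N d & cdom d (f x)],
        O (cmap c x), coord_rep setT f c d O g
      & forall w, exists v, 'd g (cmap c x) v = w].

(* The fibrewise operations are total functions on the total space; [vb_add] is
   only meaningful on pairs in the same fibre. [Phi] is the fibre component of a
   trivialization [e |-> (vb_proj e, Phi e)] over [U], with inverse [Psi]; its
   fibrewise linearity makes the fibres over [U] vector spaces isomorphic to
   R^r. *)
Record vector_bundle (R : realType) (E B : manifold R) := VectorBundle {
  vb_proj : E -> B;
  vb_zero : B -> E;
  vb_add : E -> E -> E;
  vb_scale : R -> E -> E;
  vb_rank : nat;
  vb_proj_smooth : smooth vb_proj;
  vb_proj_zero : forall b, vb_proj (vb_zero b) = b;
  vb_proj_add : forall e e', vb_proj e = vb_proj e' ->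
    vb_proj (vb_add e e') = vb_proj e;
  vb_proj_scale : forall a e, vb_proj (vb_scale a e) = vb_proj e;
  vb_trivial : forall b : B, exists U : set B,
    [/\ open U, U b &
     exists (Phi : E -> 'rV[R]_vb_rank) (Psi : B * 'rV[R]_vb_rank -> E),
     [/\ smooth_on (M := E) (N := prod_charted B (euclid R vb_rank))
           (vb_proj @^-1` U) (fun e => (vb_proj e, Phi e)),
         smooth_on (M := prod_charted B (euclid R vb_rank)) (N := E)
           (U `*` setT) Psi,
         forall e, U (vb_proj e) -> Psi (vb_proj e, Phi e) = e,
         forall x v, U x -> vb_proj (Psi (x, v)) = x /\ Phi (Psi (x, v)) = v
       & [/\ forall e e', U (vb_proj e) -> vb_proj e = vb_proj e' ->
               Phi (vb_add e e') = Phi e + Phi e',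
             forall a e, U (vb_proj e) -> Phi (vb_scale a e) = a *: Phi e
           & forall x, U x -> Phi (vb_zero x) = 0]]]
}.

Definition vb_sub (R : realType) (E B : manifold R) (p : vector_bundle E B)
  (e e' : E) : E := vb_add p e (vb_scale p (- 1) e').

Definition fibrewise_linear (R : realType) (E B E' B' : manifold R)
    (p : vector_bundle E B) (p' : vector_bundle E' B') (F : E -> E') : Prop :=
  (forall e1 e2, vb_proj p e1 = vb_proj p e2 ->
     F (vb_add p e1 e2) = vb_add p' (F e1) (F e2)) /\
  (forall a e, F (vb_scale p a e) = vb_scale p' a (F e)).

Definition is_vb_morphism (R : realType) (E B E' B' : manifold R)
    (p : vector_bundle E B) (p' : vector_bundle E' B')
    (F : E -> E') (f : B -> B') : Prop :=
  [/\ smooth F, smooth f,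
      forall e, vb_proj p' (F e) = f (vb_proj p e)
    & fibrewise_linear p p' F].

(* [lg_mul g h] is only meaningful when [lg_src g = lg_tgt h]. *)
Record lie_groupoid (R : realType) := LieGroupoid {
  arr : manifold R;
  obj : manifold R;
  src : arr -> obj;
  tgt : arr -> obj;
  unit_ : obj -> arr;
  inv : arr -> arr;
  mul : arr -> arr -> arr;
  src_smooth : smooth src;
  tgt_smooth : smooth tgt;
  src_submersion : submersion src;
  tgt_submersion : submersion tgt;
  unit_smooth : smooth unit_;
  inv_smooth : smooth inv;
  mul_smooth : smooth_on (M := prod_charted arr arr) (N := arr)
    [set p | src p.1 = tgt p.2] (fun p => mul p.1 p.2);
  src_unit : forall x, src (unit_ x) = x;
  tgt_unit : forall x, tgt (unit_ x) = x;
  src_mul : forall g h, src g = tgt h -> src (mul g h) = src h;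
  tgt_mul : forall g h, src g = tgt h -> tgt (mul g h) = tgt g;
  mulA : forall g h k, src g = tgt h -> src h = tgt k ->
    mul g (mul h k) = mul (mul g h) k;
  mul_unitl : forall g, mul (unit_ (tgt g)) g = g;
  mul_unitr : forall g, mul g (unit_ (src g)) = g;
  src_inv : forall g, src (inv g) = tgt g;
  tgt_inv : forall g, tgt (inv g) = src g;
  mul_invl : forall g, mul (inv g) g = unit_ (src g);
  mul_invr : forall g, mul g (inv g) = unit_ (tgt g)
}.

Record lg_morphism (R : realType) (H G : lie_groupoid R) := LgMorphism {
  map1 : arr H -> arr G;
  map0 : obj H -> obj G;
  map1_smooth : smooth map1;
  map0_smooth : smooth map0;
  map_src : forall h, src (map1 h) = map0 (src h);
  map_tgt : forall h, tgt (map1 h) = map0 (tgt h);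
  map_unit : forall y, map1 (unit_ y) = unit_ (map0 y);
  map_mul : forall h k, src h = tgt k -> map1 (mul h k) = mul (map1 h) (map1 k)
}.

(* The last two axioms say that the multiplication is a vector bundle morphism
   from the bundle of composable pairs of [vtot], over that of [vbase]. *)
Record vb_groupoid (R : realType) := VBGroupoid {
  vtot : lie_groupoid R;
  vbase : lie_groupoid R;
  vb1 : vector_bundle (arr vtot) (arr vbase);
  vb0 : vector_bundle (obj vtot) (obj vbase);
  vsrcP : is_vb_morphism vb1 vb0 (@src R vtot) (@src R vbase);
  vtgtP : is_vb_morphism vb1 vb0 (@tgt R vtot) (@tgt R vbase);
  vunitP : is_vb_morphism vb0 vb1 (@unit_ R vtot) (@unit_ R vbase);
  vinvP : is_vb_morphism vb1 vb1 (@inv R vtot) (@inv R vbase);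
  vmul_proj : forall v w, src v = tgt w ->
    vb_proj vb1 (mul v w) = mul (vb_proj vb1 v) (vb_proj vb1 w);
  vmul_add : forall v w v' w', src v = tgt w -> src v' = tgt w' ->
    vb_proj vb1 v = vb_proj vb1 v' -> vb_proj vb1 w = vb_proj vb1 w' ->
    mul (vb_add vb1 v v') (vb_add vb1 w w') =
    vb_add vb1 (mul v w) (mul v' w');
  vmul_scale : forall a v w, src v = tgt w ->
    mul (vb_scale vb1 a v) (vb_scale vb1 a w) = vb_scale vb1 a (mul v w)
}.

Record vbg_morphism (R : realType) (W V : vb_groupoid R)
    (f : lg_morphism (vbase W) (vbase V)) := VBGMorphism {
  vbg_map :> lg_morphism (vtot W) (vtot V);
  vbg_map1P : is_vb_morphism (vb1 W) (vb1 V) (map1 vbg_map) (map1 f);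
  vbg_map0P : is_vb_morphism (vb0 W) (vb0 V) (map0 vbg_map) (map0 f)
}.

Definition core (R : realType) (V : vb_groupoid R) (x : obj (vbase V)) :
    set (arr (vtot V)) :=
  [set c | vb_proj (vb1 V) c = unit_ x /\ src c = vb_zero (vb0 V) x].

(* A vector bundle morphism from [p] to the core of [V] covering [f]. The core
   is an embedded submanifold of the arrows of [V] with the fibrewise operations
   of [vb1 V], so [K] is smooth into the core iff it is smooth into [V]. *)
Definition is_core_morphism (R : realType) (V : vb_groupoid R)
    (E B : manifold R) (p : vector_bundle E B)
    (K : E -> arr (vtot V)) (f : B -> obj (vbase V)) : Prop :=
  [/\ smooth K, smooth f,
      forall e, core (f (vb_proj p e)) (K e)
    & fibrewise_linear p (vb1 V) K].

Section Homotopies.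
Variables (R : realType) (W V : vb_groupoid R).

(* The general notion allows different base morphisms [f], [f']. *)
Definition is_linear_nat_iso (f f' : lg_morphism (vbase W) (vbase V))
    (F : vbg_morphism f) (F' : vbg_morphism f')
    (T : obj (vtot W) -> arr (vtot V)) (tau : obj (vbase W) -> arr (vbase V)) :=
  [/\ is_vb_morphism (vb0 W) (vb1 V) T tau,
      forall w, src (T w) = map0 F w,
      forall w, tgt (T w) = map0 F' w
    & forall om : arr (vtot W),
        mul (map1 F' om) (T (src om)) = mul (T (tgt om)) (map1 F om)].

Variable f : lg_morphism (vbase W) (vbase V).

(* [f : N -> M] viewed as a map into the arrows through the units. *)
Definition unit_map0 (y : obj (vbase W)) : arr (vbase V) := unit_ (map0 f y).

Definition J1 (K : obj (vtot W) -> arr (vtot V)) (om : arr (vtot W)) :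
    arr (vtot V) :=
  let z := vb_zero (vb1 V) (map1 f (vb_proj (vb1 W) om)) in
  vb_add (vb1 V) (mul z (inv (K (src om)))) (mul (K (tgt om)) z).

Definition J0 (K : obj (vtot W) -> arr (vtot V)) (w : obj (vtot W)) :
    obj (vtot V) := tgt (K w).

Variables F F' : vbg_morphism f.

Definition diff1 (om : arr (vtot W)) : arr (vtot V) :=
  vb_sub (vb1 V) (map1 F' om) (map1 F om).

Definition diff0 (w : obj (vtot W)) : obj (vtot V) :=
  vb_sub (vb0 V) (map0 F' w) (map0 F w).

Definition homotopic_through (K : obj (vtot W) -> arr (vtot V)) : Prop :=
  (forall om, diff1 om = J1 K om) /\ (forall w, diff0 w = J0 K w).

Definition fibre_homotopy (K : obj (vtot W) -> arr (vtot V))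
    (y : obj (vbase W)) : Prop :=
  (forall d, core y d -> K (tgt d) = diff1 d) /\
  (forall w, vb_proj (vb0 W) w = y -> tgt (K w) = diff0 w).

Definition core_equivariant (K : obj (vtot W) -> arr (vtot V)) : Prop :=
  forall om : arr (vtot W),
    mul (diff1 om) (K (src om)) =
    mul (K (tgt om)) (vb_zero (vb1 V) (map1 f (vb_proj (vb1 W) om))).

Definition homotopy_of (T : obj (vtot W) -> arr (vtot V)) (w : obj (vtot W)) :
    arr (vtot V) := vb_sub (vb1 V) (T w) (unit_ (map0 F w)).

End Homotopies.

(* Main.v *)
From HB Require Import structures.
From mathcomp Require Import all_boot all_order all_algebra.
From mathcomp Require Import all_classical all_reals all_analysis.
Require Import Defs.

(** Write u(w) for the unit of F(w), and T(w) = K(w) + u(w) with K = H_T. Since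
    T(w) and u(w) have the same source and lie over the same unit, K takes its
    values in the core, and T and K determine each other.

    The target of T(w) is F'(w) exactly when t(K(w)) = F'(w) - F(w)
    ([tgt_nat_iso_ofP]): this is the objectwise half of each of the three
    conditions. Assume it. For an arrow om over h put v = (F'-F)(om), and let 0 denote the
    zero vector over f(h). Linearity of the multiplication (the interchange
    law) gives

      F'(om) T(s om) = (v + F(om)) (K(s om) + u(s om)) = v K(s om) + F(om),
      T(t om) F(om) = (K(t om) + u(t om)) (0 + F(om)) = K(t om) 0 + F(om),

    so naturality of T is the equation v K(s om) = K(t om) 0 of condition iii
    ([natural_core_equivariant]). Multiplying it on the right by the inverse of
    K(s om) gives v = (K(t om) 0) K(s om)^-1, and the interchange law once more
    splits this product as J_K(om) = 0 K(s om)^-1 + K(t om) 0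
    ([mul_core_sandwich]), whence condition ii ([core_equivariant_homotopic]).
    The remaining part of iii, on the core of W, is the homotopy formula
    evaluated at a core element, where K(s om) vanishes ([homotopic_on_core]).

    The bijection is then T = K + u read in both directions. What has to be
    checked beyond algebra is that K is smooth if and only if T is: a fibrewise
    linear combination of smooth maps into a vector bundle is smooth
    ([vb_lincomb_smooth]). In a local trivialization it becomes a linear
    combination in R^r, but the two summands come with unrelated charts;
    smoothness must be shown to be independent of the charts
    ([smooth_on_in_charts]), which rests on the chain rule for maps of class
    C^k ([Ck_comp]). *)

Set Implicit Arguments.
Unset Strict Implicit.
Unset Printing Implicit Defensive.

Import Order.TTheory GRing.Theory Num.Theory.
Import numFieldNormedType.Exports.

Local Open Scope classical_set_scope.
Local Open Scope ring_scope.

(** * Maps of class C^k on open sets *)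

Section Calculus.
Variable R : realType.
Implicit Types V W X : normedModType R.

(** The difference [g - f] vanishes near [x], so the zero map is its
    differential there. *)
Lemma near_eq_differentiable V W (f g : V -> W) (x : V) :
  (\forall y \near x, f y = g y) -> differentiable f x -> differentiable g x.
Proof.
move=> fg df.
have h0 : differentiable (g - f) x.
  have e : (g - f) \o shift x = cst ((g - f) x) + (\0 : V -> W) +o_ 0 id.
    apply/eqaddoP => e e0; near=> y.
    have -> : ((g - f) \o shift x - (cst ((g - f) x) + \0)) y = 0.
      rewrite !fctE /=.
      have -> : f (y + x) = g (y + x).
        near: y.
        move: fg; rewrite (near_shift 0 x).
        apply: filterS => z /=; by rewrite subr0 addrC //.
      by rewrite (nbhs_singleton fg) !subrr addr0 subr0.
    by rewrite normr0 mulr_ge0 // ltW.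
  have c0 : continuous (\0 : {linear V -> W}) by move=> y; exact: cvg_cst.
  apply/diff_locallyP; rewrite (diff_unique c0 e).
  by split.
have -> : g = f + (g - f) by rewrite addrC subrK.
exact: differentiableD.
Unshelve. all: by end_near. Qed.

(** The differentiation formulas below hold only at the points of [U], whereas
    directional derivatives are functions on the whole space; this lemma makes
    the formulas usable at the next order. *)
Lemma Ck_ext V W k (U : set V) (f g : V -> W) :
  open U -> {in U, f =1 g} -> Ck k U f -> Ck k U g.
Proof.
move=> oU; elim: k f g => [|k IH] f g fg /=.
  move=> cf x Ux.
  have fgx : \forall y \near x, f y = g y.
    by have := open_nbhs_nbhs (conj oU Ux); apply: filterS => y /mem_set/fg.
  rewrite /prop_for /continuous_at -(nbhs_singleton fgx).
  exact: cvg_trans (near_eq_cvg fgx) (cf x Ux).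
move=> [df Df].
have fgx x : U x -> \forall y \near x, f y = g y.
  by move=> Ux; have := open_nbhs_nbhs (conj oU Ux); apply: filterS => y /mem_set/fg.
split; first by move=> x Ux; apply: near_eq_differentiable (fgx _ Ux) (df _ Ux).
move=> v; apply: IH (Df v) => x /set_mem Ux.
exact: near_eq_derive (fgx _ Ux).
Qed.

Lemma sub_Ck V W k (U O : set V) (f : V -> W) : O `<=` U -> Ck k U f -> Ck k O f.
Proof.
move=> OU; elim: k f => [|k IH] f /=; first by move=> cf x /OU; exact: cf.
by move=> [df Df]; split=> [x /OU/df//|v]; apply: IH.
Qed.

Lemma CkS V W k (U : set V) (f : V -> W) : Ck k.+1 U f -> Ck k U f.
Proof.
elim: k f => [|k IH] f; first by move=> [df _] x /df; exact: differentiable_continuous.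
by move=> [df Df]; split=> // v; exact/IH/Df.
Qed.

Lemma Ck_cst V W k (U : set V) (c : W) : Ck k U (fun _ : V => c).
Proof.
elim: k c => [|k IH] c /=; first by move=> x _; exact: cvg_cst.
split=> [x _|v]; first exact: differentiable_cst.
have -> : (fun x : V => 'D_v (fun=> c) x) = fun=> 0.
  by apply/funext => x; exact: derive_cst.
exact: IH.
Qed.

Lemma Ck_linear V W X k (U : set V) (L : {linear W -> X}) (f : V -> W) :
  open U -> continuous L -> Ck k U f -> Ck k U (L \o f).
Proof.
move=> oU cL; elim: k f => [|k IH] f /=.
  by move=> cf x Ux; apply: continuous_comp; [exact: cf|exact: cL].
move=> [df Df]; split=> [x Ux|v].
  by apply: differentiable_comp; [exact: df|exact: linear_differentiable].
apply: Ck_ext (IH _ (Df v)) => // x /set_mem Ux /=.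
have dLf : differentiable L (f x) by exact: linear_differentiable.
rewrite deriveE; last exact: df.
rewrite deriveE; last exact: differentiable_comp (df _ Ux) dLf.
rewrite (diff_comp (df _ Ux) dLf) /=.
by rewrite diff_lin.
Qed.

Lemma CkD V W k (U : set V) (f g : V -> W) :
  open U -> Ck k U f -> Ck k U g -> Ck k U (fun x => f x + g x).
Proof.
move=> oU; elim: k f g => [|k IH] f g /=.
  by move=> cf cg x Ux; apply: (@continuousD _ _ _ f g); [exact: cf|exact: cg].
move=> [df Df] [dg Dg]; split=> [x Ux|v].
  by apply: (differentiableD (f := f) (g := g)); [exact: df|exact: dg].
apply: Ck_ext (IH _ _ (Df v) (Dg v)) => // x /set_mem Ux /=.
by rewrite -deriveD //; apply: diff_derivable; [exact: df|exact: dg].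
Qed.

Lemma Ck_sum V W k (U : set V) n (f : 'I_n -> V -> W) :
  open U -> (forall i, Ck k U (f i)) -> Ck k U (fun x => \sum_i f i x).
Proof.
move=> oU; elim: n f => [|n IH] f Cf.
  have -> : (fun x => \sum_i f i x) = fun=> 0.
    by apply/funext => x; rewrite big_ord0.
  exact: Ck_cst.
have -> : (fun x => \sum_i f i x) =
    fun x => f ord0 x + \sum_(i < n) f (lift ord0 i) x.
  by apply/funext => x; rewrite big_ord_recl.
by apply: CkD => //; exact: IH.
Qed.

Lemma CkM V k (U : set V) (f g : V -> R) :
  open U -> Ck k U f -> Ck k U g -> Ck k U (fun x => f x * g x).
Proof.
move=> oU; elim: k f g => [|k IH] f g.
  by move=> cf cg x Ux; apply: (@continuousM _ _ f g); [exact: cf|exact: cg].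
move=> Cf Cg; have [df Df] := Cf; have [dg Dg] := Cg; split=> [x Ux|v].
  by apply: (differentiableM (f := f) (g := g)); [exact: df|exact: dg].
apply: Ck_ext (CkD oU (IH _ _ (CkS Cf) (Dg v)) (IH _ _ (CkS Cg) (Df v))) => //.
move=> x /set_mem Ux /=.
by rewrite deriveM //; apply: diff_derivable; [exact: df|exact: dg].
Qed.

(** A linear map on row vectors is a finite combination of coordinates. *)
Lemma linear_rV_continuous n W (L : {linear 'rV[R]_n -> W}) : continuous L.
Proof.
have -> : (L : 'rV[R]_n -> W) = fun u => \sum_j u ord0 j *: L (delta_mx ord0 j).
  apply/funext => u; rewrite {1}[u]row_sum_delta linear_sum.
  by apply: eq_bigr => j _; rewrite linearZ.
move=> u; apply: (@Ck_sum _ _ 0%N setT _ _ openT) => // j v _.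
apply: (@cvgZr_tmp _ _ _ (nbhs v)); exact: (@coord_continuous _ _ _ ord0 j).
Qed.

Definition row_coord n (i : 'I_n) (u : 'rV[R]_n) : R := u ord0 i.

Fact row_coord_linear n (i : 'I_n) : linear (row_coord i).
Proof. by move=> a u v; rewrite /row_coord !mxE. Qed.
HB.instance Definition _ n i :=
  GRing.isLinear.Build R 'rV[R]_n R _ (@row_coord n i) (@row_coord_linear n i).

(** Reduces the chain rule to scalar-valued maps, for which the product rule is
    available. *)
Lemma Ck_coordP V n k (U : set V) (f : V -> 'rV[R]_n) :
  open U -> Ck k U f <-> forall i, Ck k U (fun x => f x ord0 i).
Proof.
move=> oU; split=> [Cf i|Cf].
  apply: (@Ck_linear _ _ _ _ _ (@row_coord n i)) => //.
  exact: linear_rV_continuous.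
rewrite (_ : f = fun x => \sum_i f x ord0 i *: delta_mx ord0 i); last first.
  by apply/funext => x; exact: row_sum_delta.
apply: Ck_sum => // i.
have lin : linear ( *:%R^~ (delta_mx ord0 i) : R -> 'rV[R]_n).
  by move=> a b c; rewrite scalerDl scalerA.
pose L : {linear R -> 'rV[R]_n} :=
  HB.pack ( *:%R^~ (delta_mx ord0 i)) (GRing.isLinear.Build _ _ _ _ _ lin).
apply: (@Ck_linear _ _ _ _ _ L) => //.
exact: scalel_continuous.
Qed.

(** By induction on [k]: the derivative of [h \o f] along [v] is the sum over [j]
    of the products of the [j]-th coordinate of ['D_v f] with the [j]-th partial
    derivative of [h] composed with [f], to which the induction hypothesis
    applies. *)
Lemma Ck_comp V n m k (U : set V) (O : set 'rV[R]_n)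
    (f : V -> 'rV[R]_n) (g : 'rV[R]_n -> 'rV[R]_m) :
  open U -> open O -> (forall x, U x -> O (f x)) ->
  Ck k U f -> Ck k O g -> Ck k U (g \o f).
Proof.
move=> oU oO UO Cf /(Ck_coordP _ _ oO) Cg; apply/(Ck_coordP _ _ oU) => i.
rewrite -[fun x => _]/((fun u => g u ord0 i) \o f).
move: (fun u => g u ord0 i) (Cg i) => {Cg i} h.
elim: k f h UO Cf => [|k IH] f h UO.
  move=> cf cg x Ux; apply: continuous_comp; first exact: cf.
  exact/cg/UO.
move=> Cf Ch; have [df Df] := Cf; have [dh Dh] := Ch; split=> [x Ux|v].
  by apply: differentiable_comp; [exact: df|exact/dh/UO].
apply: (@Ck_ext _ _ _ _
  (fun x => \sum_j 'D_v f x ord0 j * 'D_(delta_mx ord0 j) h (f x))) => //.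
  move=> x /set_mem Ux.
  have dfx := df _ Ux; have dhx := dh _ (UO _ Ux).
  rewrite [in RHS]deriveE; last exact: differentiable_comp.
  rewrite diff_comp //= -(deriveE v dfx) [in RHS](row_sum_delta ('D_v f x)).
  rewrite linear_sum; apply: eq_bigr => j _.
  by rewrite linearZ /= (deriveE _ dhx).
apply: (@Ck_sum _ _ _ _ _ (fun j x =>
  'D_v f x ord0 j * 'D_(delta_mx ord0 j) h (f x))) => // j.
apply: CkM => //.
  exact: (Ck_coordP k ('D_v f) oU).1 (Df v) j.
exact: IH _ _ UO (CkS Cf) (Dh _).
Qed.

End Calculus.

Section CinfTheory.
Variable R : realType.
Implicit Types V W : normedModType R.

Lemma open_setI_preimage V W (U : set V) (O : set W) (f : V -> W) :
  open U -> open O -> Cinf U f -> open (U `&` f @^-1` O).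
Proof.
move=> oU oO /(_ 0%N) cf; rewrite openE => x [Ux Ofx].
apply: filterI; first exact: open_nbhs_nbhs.
by apply: cf => //; exact: open_nbhs_nbhs.
Qed.

Lemma sub_Cinf V W (U O : set V) (f : V -> W) : O `<=` U -> Cinf U f -> Cinf O f.
Proof. by move=> OU Cf k; apply: sub_Ck OU (Cf k). Qed.

Lemma Cinf_comp V n m (U : set V) (O : set 'rV[R]_n)
    (f : V -> 'rV[R]_n) (g : 'rV[R]_n -> 'rV[R]_m) :
  open U -> open O -> Cinf U f -> Cinf O g ->
  Cinf (U `&` f @^-1` O) (g \o f).
Proof.
move=> oU oO Cf Cg k; have oUO := open_setI_preimage oU oO Cf.
apply: (Ck_comp oUO oO) (Cg k); first by move=> x [].
by apply: sub_Ck (Cf k) => x [].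
Qed.

Lemma Cinf_lincomb V W (U : set V) (f g : V -> W) (a : R) :
  open U -> Cinf U f -> Cinf U g -> Cinf U (fun x => f x + a *: g x).
Proof.
move=> oU Cf Cg k; apply: CkD => //.
by apply: (Ck_linear (L := *:%R a)) => //; exact: scaler_continuous.
Qed.

Lemma Cinf_lsubmx V m n (U : set V) (f : V -> 'rV[R]_(m + n)) :
  open U -> Cinf U f -> Cinf U (fun x => lsubmx (f x)).
Proof.
move=> oU Cf k; apply: (Ck_linear (L := lsubmx)) => //.
exact: continuous_lsubmx.
Qed.

Lemma Cinf_rsubmx V m n (U : set V) (f : V -> 'rV[R]_(m + n)) :
  open U -> Cinf U f -> Cinf U (fun x => rsubmx (f x)).
Proof.
move=> oU Cf k; apply: (Ck_linear (L := rsubmx)) => //.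
exact: continuous_rsubmx.
Qed.

Lemma Cinf_row_mx V m n (U : set V) (f : V -> 'rV[R]_m) (g : V -> 'rV[R]_n) :
  open U -> Cinf U f -> Cinf U g -> Cinf U (fun x => row_mx (f x) (g x)).
Proof.
move=> oU Cf Cg k; apply/(Ck_coordP _ _ oU) => i.
case: (split_ordP i) => j ->.
  have -> : (fun x => row_mx (f x) (g x) ord0 (lshift n j)) = fun x => f x ord0 j.
    by apply/funext => x; rewrite row_mxEl.
  exact: (Ck_coordP k f oU).1 (Cf k) j.
have -> : (fun x => row_mx (f x) (g x) ord0 (rshift m j)) = fun x => g x ord0 j.
  by apply/funext => x; rewrite row_mxEr.
exact: (Ck_coordP k g oU).1 (Cg k) j.
Qed.

Lemma Cinf_id V (U : set V) : Cinf U (fun x : V => x).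
Proof.
case=> [|k] /=; first by move=> x _; exact: cvg_id.
split=> [x _|v]; first exact: ex_diff.
have -> : 'D_v (fun x : V => x) = fun=> v by apply/funext => x; exact: derive_id.
exact: Ck_cst.
Qed.

End CinfTheory.

(** * Smooth maps between manifolds *)

Section Smoothness.
Variable R : realType.
Implicit Types M N P : charted R.

(** The part of [is_manifold] on which independence of charts depends. Unlike
    the full set of axioms it passes to [prod_charted] by an argument that
    takes place in the model space only. *)
Definition smooth_atlas M :=
  [/\ forall c, catlas M c -> forall x y, cdom c x -> cdom c y ->
        cmap c x = cmap c y -> x = y,
      forall c d, catlas M c -> catlas M d -> open (cmap c @` (cdom c `&` cdom d))
    & forall c d, catlas M c -> catlas M d -> chart_compat c d].

Lemma manifold_smooth_atlas (M : manifold R) : smooth_atlas M.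
Proof.
have [_ _ chM _ compM] := manifoldP M; split=> //.
  by move=> c /chM[].
move=> c d /chM[oc _ _ imc] /chM[od _ _ _].
by apply: imc; [exact: subIsetl|exact: openI].
Qed.

Lemma euclid_smooth_atlas n : smooth_atlas (euclid R n).
Proof.
split.
- by move=> c ->.
- by move=> c d -> -> /=; rewrite setIT image_id; exact: openT.
- by move=> c d -> ->; exists id => //; exact: Cinf_id.
Qed.

Lemma prod_smooth_atlas M N :
  smooth_atlas M -> smooth_atlas N -> smooth_atlas (prod_charted M N).
Proof.
move=> [injM oM compM] [injN oN compN].
have imE (c c' : chart R M _) (d d' : chart R N _) :
    cmap (prod_chart c d) @` (cdom (prod_chart c d) `&` cdom (prod_chart c' d'))
    = (lsubmx @^-1` (cmap c @` (cdom c `&` cdom c'))) `&`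
      (rsubmx @^-1` (cmap d @` (cdom d `&` cdom d'))).
  apply/seteqP; split=> [_ [[x y] /= [[cx dy] [cx' dy']] <-]|u /=].
    by rewrite row_mxKl row_mxKr; split; [exists x|exists y].
  move=> [[x [cx cx'] xu] [y [dy dy'] yu]].
  by exists (x, y) => //=; rewrite xu yu hsubmxK.
have oI (c c' : chart R M _) (d d' : chart R N _) :
    catlas M c -> catlas M c' -> catlas N d -> catlas N d' ->
    open ((lsubmx @^-1` (cmap c @` (cdom c `&` cdom c'))) `&`
      (rsubmx @^-1` (cmap d @` (cdom d `&` cdom d')))
      : set 'rV[R]_(cdim M + cdim N)).
  move=> Mc Mc' Nd Nd'; apply: openI; apply: open_comp.
  - by move=> u _; exact: continuous_lsubmx.
  - exact: oM.
  - by move=> u _; exact: continuous_rsubmx.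
  - exact: oN.
split.
- move=> _ [c [d [Mc Nd ->]]] [x y] [x' y'] /= [cx dy] [cx' dy'].
  by move=> /eq_row_mx[/(injM _ Mc _ _ cx cx') -> /(injN _ Nd _ _ dy dy') ->].
- move=> _ _ [c [d [Mc Nd ->]]] [c' [d' [Mc' Nd' ->]]].
  by rewrite imE; exact: oI.
- move=> _ _ [c [d [Mc Nd ->]]] [c' [d' [Mc' Nd' ->]]].
  have [g Cg gE] := compM _ _ Mc Mc'; have [h Ch hE] := compN _ _ Nd Nd'.
  exists (fun u => row_mx (g (lsubmx u)) (h (rsubmx u))); last first.
    by move=> [x y] /= [cx dy] [cx' dy']; rewrite row_mxKl row_mxKr gE // hE.
  have oP := oI _ _ _ _ Mc Mc' Nd Nd'; rewrite imE.
  apply: Cinf_row_mx => // k.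
  + apply: (@Ck_comp _ _ _ _ _ _ (cmap c @` (cdom c `&` cdom c')) lsubmx) => //.
    * exact: oM.
    * by move=> u [].
    * by apply: (Cinf_lsubmx oP); exact: Cinf_id.
  + apply: (@Ck_comp _ _ _ _ _ _ (cmap d @` (cdom d `&` cdom d')) rsubmx) => //.
    * exact: oN.
    * by move=> u [].
    * by apply: (Cinf_rsubmx oP); exact: Cinf_id.
Qed.

(** The coordinate expression in the charts [c], [d] is the given one, conjugated
    by the two transition maps. *)
Lemma smooth_on_in_charts M N (A : set M) (f : M -> N) x
    (c : chart R M (cdim M)) (d : chart R N (cdim N)) :
  smooth_atlas M -> smooth_atlas N -> smooth_on A f -> A x ->
  catlas M c -> cdom c x -> catlas N d -> cdom d (f x) ->
  exists O g, O (cmap c x) /\ coord_rep A f c d O g.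
Proof.
move=> [injM oM compM] [injN oN compN] sf Ax Mc cx Nd dfx.
have [c0 [d0 [ O0 [g0 [[Mc0 c0x] [Nd0 d0fx] O0x [oO0 Cg0 repf]]]]]] := sf _ Ax.
have [k Ck kE] := compM _ _ Mc Mc0; have [l Cl lE] := compN _ _ Nd0 Nd.
have oP := oM _ _ Mc Mc0; have oQ := oN _ _ Nd0 Nd.
set P := cmap c @` _ in Ck oP; set Q := cmap d0 @` _ in Cl oQ.
have oPO := open_setI_preimage oP oO0 Ck.
have Cgk := Cinf_comp oP oO0 Ck Cg0.
exists (P `&` k @^-1` O0 `&` (g0 \o k) @^-1` Q), (l \o (g0 \o k)); split.
  have [_ gx] := repf _ Ax c0x O0x.
  split; first by split; [exists x|rewrite /= kE].
  by rewrite /= kE // -gx; exists (f x).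
split.
- exact: open_setI_preimage.
- exact: Cinf_comp.
move=> y Ay cy [[[z [cz c0z] zy]] /= Oky Qy].
have zE := injM _ Mc _ _ cz cy zy; rewrite {z cz zy}zE in c0z.
rewrite kE // in Oky Qy *; have [d0fy gy] := repf _ Ay c0z Oky.
rewrite -gy in Qy *; case: Qy => w [d0w dw] wE.
have wfy := injN _ Nd0 _ _ d0w d0fy wE.
by rewrite wfy in dw; rewrite lE.
Qed.

Lemma smooth_on_comp M N P (A : set M) (B : set N) (f : M -> N) (g : N -> P) :
  smooth_atlas N -> smooth_atlas P -> (forall x, A x -> B (f x)) ->
  smooth_on A f -> smooth_on B g -> smooth_on A (g \o f).
Proof.
move=> aN aP AB sf sg x Ax.
have [c [d [ O [phi [[Mc cx] [Nd dfx] Ox [oO Cphi repf]]]]]] := sf _ Ax.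
have [_ [e [_ [_ [_ [Pe efx] _ _]]]]] := sg _ (AB _ Ax).
have [Q [psi [Qfx [oQ Cpsi repg]]]] :=
  smooth_on_in_charts aN aP sg (AB _ Ax) Nd dfx Pe efx.
exists c, e, (O `&` phi @^-1` Q), (psi \o phi); split=> //.
  by split=> //=; have [_ <-] := repf _ Ax cx Ox.
split.
- exact: open_setI_preimage.
- exact: Cinf_comp.
move=> y Ay cy [Oy /= Qy]; have [dfy fyE] := repf _ Ay cy Oy.
by rewrite -fyE in Qy *; exact: repg (AB _ Ay) dfy Qy.
Qed.

Lemma smooth_comp (M N P : manifold R) (f : M -> N) (g : N -> P) :
  smooth f -> smooth g -> smooth (g \o f).
Proof. by apply: smooth_on_comp => //; exact: manifold_smooth_atlas. Qed.

Lemma sub_smooth_on M N (A B : set M) (f : M -> N) :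
  A `<=` B -> smooth_on B f -> smooth_on A f.
Proof.
move=> AB sf x Ax; have [c [d [ O [g [? ? ? [? ? rep]]]]]] := sf _ (AB _ Ax).
by exists c, d, O, g; split=> //; split=> // y /AB; exact: rep.
Qed.

Lemma smooth_on_ext M N (A : set M) (f g : M -> N) :
  (forall x, A x -> f x = g x) -> smooth_on A f -> smooth_on A g.
Proof.
move=> fg sf x Ax; have [c [d [ O [h [? [? dfx] ? [? ? rep]]]]]] := sf _ Ax.
exists c, d, O, h; split=> //; first by rewrite -fg.
by split=> // y Ay; rewrite -fg //; exact: rep.
Qed.

(** The coordinate expression near [x] is cut down to the image of [A]. *)
Lemma smooth_local (M : manifold R) N (f : M -> N) :
  (forall x, exists A : set M, [/\ open A, A x & smooth_on A f]) -> smooth f.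
Proof.
have [_ _ chM _ _] := manifoldP M.
move=> locf x _; have [A [oA Ax sf]] := locf x.
have [c [d [ O [g [[Mc cx] ? Ox [oO Cg rep]]]]]] := sf _ Ax.
have [oc injc _ imc] := chM _ Mc.
exists c, d, (O `&` cmap c @` (cdom c `&` A)), g; split=> //.
  by split=> //; exists x.
split.
- apply: openI => //; apply: imc; [exact: subIsetl|exact: openI].
- by apply: sub_Cinf Cg => u [].
move=> y _ cy [Oy [z [cz Az] zy]]; apply: rep => //.
by rewrite -(injc _ _ cz cy zy).
Qed.

(** Coordinate expressions are continuous and charts are homeomorphisms. *)
Lemma smooth_open_preimage (M N : manifold R) (f : M -> N) (U : set N) :
  smooth f -> open U -> open (f @^-1` U).
Proof.
have [_ _ chM _ _] := manifoldP M; have [_ _ chN _ _] := manifoldP N.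
move=> sf oU; rewrite openE => x Ufx.
have [c [d [ O [g [[Mc cx] [Nd dfx] Ox [oO Cg rep]]]]]] := sf x I.
have [_ _ prec _] := chM _ Mc; have [od injd _ imd] := chN _ Nd.
have oQ : open (cmap d @` (cdom d `&` U)).
  by apply: imd; [exact: subIsetl|exact: openI].
rewrite /interior nbhsE /=.
exists (cdom c `&` cmap c @^-1` (O `&` g @^-1` (cmap d @` (cdom d `&` U)))).
  split; first by apply: prec; exact: open_setI_preimage.
  by split=> //; split=> //=; have [_ <-] := rep x I cx Ox; exists (f x).
move=> y [cy [Oy /=]]; have [dfy <-] := rep y I cy Oy.
by move=> [z [dz Uz] zE]; rewrite -(injd _ _ dz dfy zE).
Qed.

(** A chart of the product is a chart of [N] times the identity, so the second
    block of a coordinate expression is the [R^r]-component itself, and once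
    both maps are read in the same charts the combination can be formed on
    these blocks. *)
Lemma smooth_on_fibre_lincomb M N r (A : set M) (a : R)
    (h h' : M -> prod_charted N (euclid R r)) :
  smooth_atlas M -> smooth_atlas N -> (forall x, A x -> (h x).1 = (h' x).1) ->
  smooth_on A h -> smooth_on A h' ->
  smooth_on (N := prod_charted N (euclid R r)) A
    (fun x => ((h x).1, (h x).2 + a *: (h' x).2 : 'rV[R]_r)).
Proof.
move=> aM aN hh' sh sh' x Ax.
have aP := prod_smooth_atlas aN (euclid_smooth_atlas r).
have [c [d [ O [g [[Mc cx] [Pd dhx] Ox [oO Cg rep]]]]]] := sh _ Ax.
(* The two maps agree in [N] and the charts of [R^r] are global. *)
have dh'x : cdom d (h' x).
  move: Pd dhx => [d1 [d2 [_ d2E dE]]].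
  by rewrite dE d2E /= => -[]; rewrite hh'.
have [Q [g' [Qx [oQ Cg' rep']]]] :=
  smooth_on_in_charts aM aP sh' Ax Mc cx Pd dh'x.
exists c, d, (O `&` Q),
  (fun u => row_mx (lsubmx (g u)) (rsubmx (g u) + a *: rsubmx (g' u))).
have oOO : open (O `&` Q) by exact: openI.
have {}Cg : Cinf (O `&` Q) g by apply: sub_Cinf Cg => u [].
have {}Cg' : Cinf (O `&` Q) g' by apply: sub_Cinf Cg' => u [].
have [d1 [d2 [_ d2E dE]]] := Pd.
split=> //.
- split=> //; move: dhx; rewrite dE d2E /=; by case.
split=> //.
  apply: Cinf_row_mx; [exact: oOO|exact: Cinf_lsubmx|].
  by apply: Cinf_lincomb; [exact: oOO|exact: Cinf_rsubmx|exact: Cinf_rsubmx].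
move=> y Ay cy [Oy Qy].
have [dhy <-] := rep _ Ay cy Oy; have [dh'y <-] := rep' _ Ay cy Qy.
move: dhy; rewrite dE d2E /= => -[d1y _]; split=> //.
by rewrite !row_mxKl !row_mxKr.
Qed.

(** Near each point: trivialize, combine in [R^r], and return to [E] through the
    inverse of the trivialization. *)
Lemma vb_lincomb_smooth (M E B : manifold R) (p : vector_bundle E B) (a : R)
    (S T : M -> E) :
  smooth S -> smooth T -> (forall x, vb_proj p (S x) = vb_proj p (T x)) ->
  smooth (fun x => vb_add p (S x) (vb_scale p a (T x))).
Proof.
move=> sS sT pST; apply: smooth_local => x.
have [U [oU Ux [Phi [Psi [sPhi sPsi PsiK _ [PhiD PhiZ _]]]]]] :=
  vb_trivial p (vb_proj p (S x)).
exists ((vb_proj p \o S) @^-1` U); split=> //.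
  by apply: smooth_open_preimage => //; apply: smooth_comp => //; exact: vb_proj_smooth.
set A := _ @^-1` U.
have aP := prod_smooth_atlas (manifold_smooth_atlas B)
  (euclid_smooth_atlas (vb_rank p)).
have aE := manifold_smooth_atlas E.
have sPhi_comp (Q : M -> E) : (forall y, vb_proj p (Q y) = vb_proj p (S y)) ->
    smooth Q -> smooth_on (N := prod_charted B (euclid R (vb_rank p))) A
      (fun y => (vb_proj p (Q y), Phi (Q y))).
  move=> QS sQ; apply: (smooth_on_comp aE aP _ _ sPhi) => /=.
    by move=> y; rewrite /A /= -QS.
  by apply: sub_smooth_on sQ.
have := smooth_on_fibre_lincomb a (manifold_smooth_atlas M)
  (manifold_smooth_atlas B) _ (sPhi_comp _ (fun=> erefl) sS)
  (sPhi_comp _ (fun y => esym (pST y)) sT).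
move=> /(_ (fun y _ => pST y)) slin.
apply: smooth_on_ext (smooth_on_comp aP aE _ slin sPsi); last by move=> y; split.
move=> y Ay /=.
have pZ : vb_proj p (S y) = vb_proj p (vb_scale p a (T y)).
  by rewrite vb_proj_scale.
rewrite -PhiZ -?pST // -PhiD // -{1}(vb_proj_add pZ) PsiK //.
by rewrite vb_proj_add.
Qed.

End Smoothness.

(** * The vector space structure of the fibres *)

Section VectorBundleAlgebra.
Variables (R : realType) (E B : manifold R) (p : vector_bundle E B).
Local Notation "e +% e'" := (vb_add p e e') (at level 50, left associativity).
Local Notation "a *% e" := (vb_scale p a e) (at level 40).

(** A local trivialization identifies the fibre with [R^r] compatibly with
    the operations, so every identity of vector spaces holds in
    the fibre: the lemmas below check it in [R^r] and use injectivity. *)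
Lemma vb_fibre_coordinates (b : B) : exists phi : E -> 'rV[R]_(vb_rank p),
  [/\ forall e e', vb_proj p e = b -> vb_proj p e' = b -> phi e = phi e' -> e = e',
      forall e e', vb_proj p e = b -> vb_proj p e' = b ->
        phi (e +% e') = phi e + phi e',
      forall a e, vb_proj p e = b -> phi (a *% e) = a *: phi e
    & phi (vb_zero p b) = 0].
Proof.
have [U [_ Ub [Phi [Psi [_ _ PsiK _ [PhiD PhiZ Phi0]]]]]] := vb_trivial p b.
exists Phi; split.
- by move=> e e' eb e'b ee'; rewrite -[e]PsiK ?eb // -[e']PsiK ?e'b // ee'.
- by move=> e e' eb e'b; rewrite PhiD ?eb.
- by move=> a e eb; rewrite PhiZ ?eb.
- exact: Phi0.
Qed.

Lemma vb_proj_sub e e' : vb_proj p e = vb_proj p e' ->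
  vb_proj p (vb_sub p e e') = vb_proj p e.
Proof. by move=> ee'; rewrite vb_proj_add // vb_proj_scale. Qed.

Lemma vb_addC e e' : vb_proj p e = vb_proj p e' -> e +% e' = e' +% e.
Proof.
move=> ee'; have [phi [inj phiD _ _]] := vb_fibre_coordinates (vb_proj p e).
by apply: inj; rewrite ?vb_proj_add ?phiD // addrC.
Qed.

Lemma vb_add0r e b : vb_proj p e = b -> e +% vb_zero p b = e.
Proof.
move=> eb; have [phi [inj phiD _ phi0]] := vb_fibre_coordinates b.
by apply: inj; rewrite ?vb_proj_add ?phiD ?phi0 ?addr0 // vb_proj_zero.
Qed.

Lemma vb_add0l e b : vb_proj p e = b -> vb_zero p b +% e = e.
Proof. by move=> eb; rewrite vb_addC ?vb_add0r // vb_proj_zero. Qed.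

Lemma vb_scale1 e : 1 *% e = e.
Proof.
have [phi [inj _ phiZ _]] := vb_fibre_coordinates (vb_proj p e).
by apply: inj; rewrite ?vb_proj_scale ?phiZ ?scale1r.
Qed.

Lemma vb_scale0 e : 0 *% e = vb_zero p (vb_proj p e).
Proof.
have [phi [inj _ phiZ phi0]] := vb_fibre_coordinates (vb_proj p e).
by apply: inj; rewrite ?vb_proj_scale ?vb_proj_zero ?phiZ ?phi0 ?scale0r.
Qed.

Lemma vb_subK e e' : vb_proj p e = vb_proj p e' -> vb_sub p e e' +% e' = e.
Proof.
move=> ee'; have [phi [inj phiD phiZ _]] := vb_fibre_coordinates (vb_proj p e).
apply: inj => //; first by rewrite vb_proj_add vb_proj_sub.
by rewrite !phiD ?phiZ ?vb_proj_scale ?vb_proj_sub // scaleN1r subrK.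
Qed.

Lemma vb_addK e e' : vb_proj p e = vb_proj p e' -> vb_sub p (e +% e') e' = e.
Proof.
move=> ee'; have [phi [inj phiD phiZ _]] := vb_fibre_coordinates (vb_proj p e).
apply: inj => //; first by rewrite vb_proj_sub vb_proj_add.
by rewrite !phiD ?phiZ ?vb_proj_scale ?vb_proj_add // scaleN1r addrK.
Qed.

Lemma vb_addIr e1 e2 e : vb_proj p e1 = vb_proj p e -> vb_proj p e2 = vb_proj p e ->
  e1 +% e = e2 +% e -> e1 = e2.
Proof. by move=> pe1 pe2 e12; rewrite -(vb_addK pe1) e12 vb_addK. Qed.

Lemma vb_add_lincombACA e1 e2 e1' e2' a :
  vb_proj p e1 = vb_proj p e2 -> vb_proj p e1' = vb_proj p e1 ->
  vb_proj p e2' = vb_proj p e1 ->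
  (e1 +% e2) +% a *% (e1' +% e2') = (e1 +% a *% e1') +% (e2 +% a *% e2').
Proof.
move=> p12 p1' p2'.
have [phi [inj phiD phiZ _]] := vb_fibre_coordinates (vb_proj p e1).
apply: inj; rewrite ?(phiD, phiZ, vb_proj_scale, vb_proj_add) ?p1' ?p2' //.
by rewrite scalerDr addrACA.
Qed.

Lemma vb_scale_lincomb e e' a c : vb_proj p e' = vb_proj p e ->
  c *% e +% a *% (c *% e') = c *% (e +% a *% e').
Proof.
move=> p'; have [phi [inj phiD phiZ _]] := vb_fibre_coordinates (vb_proj p e).
apply: inj; rewrite ?(phiD, phiZ, vb_proj_scale, vb_proj_add) ?p' //.
by rewrite scalerDr !scalerA mulrC.
Qed.

End VectorBundleAlgebra.

(** * Vector bundle morphisms *)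

Section VBMorphisms.
Variable R : realType.

Section Linear.
Variables (E B E' B' : manifold R).
Variables (p : vector_bundle E B) (p' : vector_bundle E' B').
Variables (F G : E -> E') (f : B -> B').
Hypotheses (vbF : is_vb_morphism p p' F f).

Lemma vb_morphism_proj e : vb_proj p' (F e) = f (vb_proj p e).
Proof. by have [] := vbF. Qed.

Lemma vb_morphism_zero b : F (vb_zero p b) = vb_zero p' (f b).
Proof.
have [_ _ pF [_ FZ]] := vbF.
by rewrite -[in LHS](vb_proj_zero p b) -vb_scale0 FZ vb_scale0 pF vb_proj_zero.
Qed.

Lemma vb_morphism_add e e' : vb_proj p e = vb_proj p e' ->
  F (vb_add p e e') = vb_add p' (F e) (F e').
Proof. by have [_ _ _ [FD _]] := vbF; exact: FD. Qed.

Lemma vb_morphism_sub e e' : vb_proj p e = vb_proj p e' ->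
  F (vb_sub p e e') = vb_sub p' (F e) (F e').
Proof.
by have [_ _ _ [FD FZ]] := vbF => ee'; rewrite FD ?FZ // vb_proj_scale.
Qed.

Lemma vb_morphism_lincomb a : is_vb_morphism p p' G f ->
  is_vb_morphism p p' (fun e => vb_add p' (F e) (vb_scale p' a (G e))) f.
Proof.
have [sF sf pF [FD FZ]] := vbF => -[sG _ pG [GD GZ]].
have pFG e : vb_proj p' (F e) = vb_proj p' (G e) by rewrite pF pG.
split=> //.
- exact: vb_lincomb_smooth.
- by move=> e; rewrite vb_proj_add ?vb_proj_scale.
split=> [e1 e2 p12|c e].
  by rewrite FD // GD // vb_add_lincombACA ?pF ?pG ?p12.
by rewrite FZ GZ vb_scale_lincomb.
Qed.

End Linear.

Lemma vb_morphism_comp (E1 B1 E2 B2 E3 B3 : manifold R)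
    (p1 : vector_bundle E1 B1) (p2 : vector_bundle E2 B2)
    (p3 : vector_bundle E3 B3) F f G g :
  is_vb_morphism p1 p2 F f -> is_vb_morphism p2 p3 G g ->
  is_vb_morphism p1 p3 (G \o F) (g \o f).
Proof.
move=> [sF sf pF [FD FZ]] [sG sg pG [GD GZ]]; split.
- exact: smooth_comp sF sG.
- exact: smooth_comp sf sg.
- by move=> e /=; rewrite pG pF.
split=> [e1 e2 p12|c e] /=; last by rewrite FZ GZ.
by rewrite FD // GD // !pF p12.
Qed.

End VBMorphisms.

(** * Multiplication with core elements in a VB-groupoid *)

Section VBGroupoidAlgebra.
Variables (R : realType) (V : vb_groupoid R).
Local Notation G := (vbase V).
Local Notation zero1 := (vb_zero (vb1 V)).
Local Notation zero0 := (vb_zero (vb0 V)).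
Local Notation proj1 := (vb_proj (vb1 V)).
Implicit Types (v c : arr (vtot V)) (g : arr G).

Lemma inv_unit (L : lie_groupoid R) (x : obj L) : inv (unit_ x) = unit_ x.
Proof.
by rewrite -[LHS]mul_unitr src_inv tgt_unit mul_invl src_unit.
Qed.

Lemma mulKr (L : lie_groupoid R) (g h : arr L) : src g = tgt h ->
  mul (mul g h) (inv h) = g.
Proof.
by move=> gh; rewrite -mulA ?tgt_inv // mul_invr -gh mul_unitr.
Qed.

Lemma mulVKr (L : lie_groupoid R) (g h : arr L) : src g = src h ->
  mul (mul g (inv h)) h = g.
Proof.
by move=> gh; rewrite -mulA ?src_inv ?tgt_inv // mul_invl -gh mul_unitr.
Qed.

Lemma src_zero g : src (zero1 g) = zero0 (src g).
Proof. exact: vb_morphism_zero (vsrcP V) _. Qed.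

Lemma tgt_zero g : tgt (zero1 g) = zero0 (tgt g).
Proof. exact: vb_morphism_zero (vtgtP V) _. Qed.

Lemma unit_zero x : unit_ (zero0 x) = zero1 (unit_ x).
Proof. exact: vb_morphism_zero (vunitP V) _. Qed.

Lemma proj_tgt v : vb_proj (vb0 V) (tgt v) = tgt (proj1 v).
Proof. exact: vb_morphism_proj (vtgtP V) _. Qed.

Lemma proj_src v : vb_proj (vb0 V) (src v) = src (proj1 v).
Proof. exact: vb_morphism_proj (vsrcP V) _. Qed.

Lemma proj_unit x : proj1 (unit_ x) = unit_ (vb_proj (vb0 V) x).
Proof. exact: vb_morphism_proj (vunitP V) _. Qed.

Lemma proj_mul_core_zero g c : core (tgt g) c -> proj1 (mul c (zero1 g)) = g.
Proof.
move=> [pc sc]; rewrite vmul_proj ?sc ?tgt_zero // pc vb_proj_zero.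
exact: mul_unitl.
Qed.

(** The interchange law applied to [(c + unit (t v)) (0 + v)]. *)
Lemma mul_core_translate v c : core (tgt (proj1 v)) c ->
  mul (vb_add (vb1 V) c (unit_ (tgt v))) v =
  vb_add (vb1 V) (mul c (zero1 (proj1 v))) v.
Proof.
move=> [pc sc].
rewrite -{2}(vb_add0l (p := vb1 V) (erefl (proj1 v))) vmul_add ?mul_unitl //.
- by rewrite sc tgt_zero.
- by rewrite src_unit.
- by rewrite pc proj_unit proj_tgt.
- by rewrite vb_proj_zero.
Qed.

(** The interchange law applied to [(c 0 + 0) (0 + d^-1)]: the source of [c 0]
    is zero, so [c 0] multiplies with a zero unit, and [0] with [d^-1]. *)
Lemma mul_core_sandwich g c d : core (tgt g) c -> core (src g) d ->
  vb_add (vb1 V) (mul (zero1 g) (inv d)) (mul c (zero1 g)) =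
  mul (mul c (zero1 g)) (inv d).
Proof.
move=> Cc [pd sd]; have [pc sc] := Cc.
have s0 : src (mul c (zero1 g)) = zero0 (src g).
  by rewrite src_mul ?src_zero // sc tgt_zero.
have pinv : proj1 (inv d) = unit_ (src g).
  by rewrite (vb_morphism_proj (vinvP V)) pd inv_unit.
have s0d : src (zero1 g) = tgt (inv d) by rewrite src_zero tgt_inv sd.
have p0d : proj1 (mul (zero1 g) (inv d)) = g.
  by rewrite vmul_proj // pinv vb_proj_zero mul_unitr.
rewrite vb_addC ?p0d ?proj_mul_core_zero //.
(* The left factor [c 0] becomes [c 0] times the zero vector over the unit at
   [src g], and the interchange law recombines the two summands. *)
rewrite -{1}(mul_unitr (mul c (zero1 g))) s0 unit_zero -vmul_add //.
- by rewrite vb_add0r ?proj_mul_core_zero // vb_add0l.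
- by rewrite s0 tgt_zero tgt_unit.
- by rewrite proj_mul_core_zero // vb_proj_zero.
- by rewrite vb_proj_zero.
Qed.

End VBGroupoidAlgebra.

(** * Homotopies and linear natural isomorphisms *)

Section HomotopyNaturalIsomorphism.
Variables (R : realType) (W V : vb_groupoid R).
Variable f : lg_morphism (vbase W) (vbase V).
Variables F F' : vbg_morphism f.
Local Notation proj1 := (vb_proj (vb1 V)).

Lemma vbg_proj (F1 : vbg_morphism f) om :
  proj1 (map1 F1 om) = map1 f (vb_proj (vb1 W) om).
Proof. exact: vb_morphism_proj (vbg_map1P F1) _. Qed.

Lemma vbg_proj0 (F1 : vbg_morphism f) w :
  vb_proj (vb0 V) (map0 F1 w) = map0 f (vb_proj (vb0 W) w).
Proof. exact: vb_morphism_proj (vbg_map0P F1) _. Qed.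

Lemma unit_vbg_morphismP :
  is_vb_morphism (vb0 W) (vb1 V) (fun w => unit_ (map0 F w)) (unit_map0 f).
Proof. exact: vb_morphism_comp (vbg_map0P F) (vunitP V). Qed.

(** Smoothness and linearity into the core are those into the arrows of [V], so a
    core morphism is a bundle morphism over the units with zero source; the
    closure of bundle morphisms under linear combinations thus applies to it. *)
Lemma core_morphismP K : is_core_morphism (vb0 W) K (map0 f) <->
  is_vb_morphism (vb0 W) (vb1 V) K (unit_map0 f) /\
  forall w, src (K w) = vb_zero (vb0 V) (map0 f (vb_proj (vb0 W) w)).
Proof.
split=> [[sK _ coreK linK]|[[sK _ pK linK] srcK]].
  split; last by move=> w; have [] := coreK w.
  split=> //; first by have [] := unit_vbg_morphismP.
  by move=> w; have [] := coreK w.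
by split=> //; exact: map0_smooth.
Qed.

(** The inverse of [homotopy_of F]. *)
Definition nat_iso_of (K : obj (vtot W) -> arr (vtot V)) w :=
  vb_add (vb1 V) (K w) (unit_ (map0 F w)).

Lemma homotopy_ofK T : is_vb_morphism (vb0 W) (vb1 V) T (unit_map0 f) ->
  nat_iso_of (homotopy_of F T) = T.
Proof.
move=> vbT; apply/funext => w; apply: vb_subK.
by rewrite (vb_morphism_proj vbT) (vb_morphism_proj unit_vbg_morphismP).
Qed.

Lemma homotopy_of_core_morphism T :
  is_vb_morphism (vb0 W) (vb1 V) T (unit_map0 f) ->
  (forall w, src (T w) = map0 F w) ->
  is_core_morphism (vb0 W) (homotopy_of F T) (map0 f).
Proof.
move=> vbT sT; apply/core_morphismP; split.
  exact: vb_morphism_lincomb unit_vbg_morphismP.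
move=> w; rewrite (vb_morphism_sub (vsrcP V)).
  have F0 : src (unit_ (map0 F w)) = map0 F w := src_unit _.
  rewrite F0 sT -(vbg_proj0 F).
  (* [F w - F w = 0], read off from [(0 + F w) - F w = 0]. *)
  rewrite -[X in vb_sub _ X](vb_add0l (p := vb0 V) erefl) vb_addK //.
  by rewrite vb_proj_zero.
by rewrite (vb_morphism_proj vbT) (vb_morphism_proj unit_vbg_morphismP).
Qed.

Section CoreMorphism.
Variable K : obj (vtot W) -> arr (vtot V).
Hypothesis coreK : is_core_morphism (vb0 W) K (map0 f).

Let vbK : is_vb_morphism (vb0 W) (vb1 V) K (unit_map0 f).
Proof. by have [/(_ coreK)[]] := core_morphismP K. Qed.

Let core_tgt om : core (tgt (map1 f (vb_proj (vb1 W) om))) (K (tgt om)).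
Proof.
by have [_ _ + _] := coreK => /(_ (tgt om)); rewrite proj_tgt map_tgt.
Qed.

Let core_src om : core (src (map1 f (vb_proj (vb1 W) om))) (K (src om)).
Proof.
by have [_ _ + _] := coreK => /(_ (src om)); rewrite proj_src map_src.
Qed.

Let proj_K_unit w : proj1 (K w) = proj1 (unit_ (map0 F w)).
Proof. by rewrite (vb_morphism_proj vbK) (vb_morphism_proj unit_vbg_morphismP). Qed.

Lemma nat_iso_of_vb_morphism :
  is_vb_morphism (vb0 W) (vb1 V) (nat_iso_of K) (unit_map0 f).
Proof.
have -> : nat_iso_of K = fun w =>
    vb_add (vb1 V) (K w) (vb_scale (vb1 V) 1 (unit_ (map0 F w))).
  by apply/funext => w; rewrite vb_scale1.
exact: vb_morphism_lincomb unit_vbg_morphismP.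
Qed.

Lemma nat_iso_ofK : homotopy_of F (nat_iso_of K) = K.
Proof. by apply/funext => w; apply: vb_addK. Qed.

Lemma src_nat_iso_of w : src (nat_iso_of K w) = map0 F w.
Proof.
have [_ _ cK _] := coreK; have [_ sK] := cK w.
rewrite (vb_morphism_add (vsrcP V)) // sK src_unit vb_add0l //.
exact: vbg_proj0.
Qed.

(** The objectwise half of each of the three conditions. *)
Lemma tgt_nat_iso_ofP w :
  tgt (nat_iso_of K w) = map0 F' w <-> tgt (K w) = diff0 F F' w.
Proof.
have pK : vb_proj (vb0 V) (tgt (K w)) = vb_proj (vb0 V) (map0 F w).
  by rewrite proj_tgt proj_K_unit -proj_tgt tgt_unit.
rewrite (vb_morphism_add (vtgtP V)) // tgt_unit.
split=> [F'E|->]; first by rewrite /diff0 -F'E vb_addK.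
by apply: vb_subK; rewrite !vbg_proj0.
Qed.

Section Objectwise.
Hypothesis tgtK : forall w, tgt (K w) = diff0 F F' w.

Let proj_diff1 om : proj1 (diff1 F F' om) = map1 f (vb_proj (vb1 W) om).
Proof. by rewrite vb_proj_sub !vbg_proj. Qed.

Let src_diff1 om : src (diff1 F F' om) = tgt (K (src om)).
Proof.
by rewrite tgtK (vb_morphism_sub (vsrcP V)) ?vbg_proj // !map_src.
Qed.

(** Both sides of the naturality square are [F om] plus the corresponding side of
    the equivariance equation, and [F om] cancels in the fibre. *)
Lemma natural_core_equivariant :
  (forall om, mul (map1 F' om) (nat_iso_of K (src om)) =
              mul (nat_iso_of K (tgt om)) (map1 F om)) <->
  core_equivariant F F' K.
Proof.
have lhsE om : mul (map1 F' om) (nat_iso_of K (src om)) =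
    vb_add (vb1 V) (mul (diff1 F F' om) (K (src om))) (map1 F om).
  have pF : proj1 (map1 F' om) = proj1 (map1 F om) by rewrite !vbg_proj.
  rewrite -{1}(vb_subK pF) -/(diff1 F F' om) vmul_add //.
  - by rewrite -map_src mul_unitr.
  - by rewrite tgt_unit map_src.
  - by rewrite proj_diff1 vbg_proj.
have rhsE om : mul (nat_iso_of K (tgt om)) (map1 F om) =
    vb_add (vb1 V) (mul (K (tgt om))
      (vb_zero (vb1 V) (map1 f (vb_proj (vb1 W) om)))) (map1 F om).
  by rewrite /nat_iso_of -map_tgt mul_core_translate ?vbg_proj.
split=> [nat om|eqv om]; last by rewrite lhsE rhsE eqv.
apply: (@vb_addIr _ _ _ (vb1 V) _ _ (map1 F om)); last by rewrite -lhsE -rhsE.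
  rewrite vmul_proj // proj_diff1 vbg_proj.
  by have [-> _] := core_src om; rewrite mul_unitr.
by rewrite proj_mul_core_zero ?vbg_proj.
Qed.

(** [J1] is the product of the right-hand side of the equivariance equation with
    the inverse of [K (src om)], and right multiplication by [K (src om)] is
    invertible. *)
Lemma core_equivariant_homotopic :
  core_equivariant F F' K <-> forall om, diff1 F F' om = J1 f K om.
Proof.
have JE om : J1 f K om = mul (mul (K (tgt om))
    (vb_zero (vb1 V) (map1 f (vb_proj (vb1 W) om)))) (inv (K (src om))).
  exact: mul_core_sandwich.
split=> [eqv om|hom om]; first by rewrite JE -eqv mulKr.
rewrite hom JE mulVKr //.
have [_ st] := core_tgt om; have [_ ss] := core_src om.
by rewrite src_mul ?src_zero ?ss // st tgt_zero.
Qed.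

(** At a core element [d] the source is zero, so the first summand of [J1] is
    zero, and the second is [K (tgt d)] times the unit at its source. *)
Lemma homotopic_on_core : (forall om, diff1 F F' om = J1 f K om) ->
  forall y d, core y d -> K (tgt d) = diff1 F F' d.
Proof.
move=> hom y d [pd sd]; rewrite hom /J1 pd sd (vb_morphism_zero vbK).
rewrite map_unit /unit_map0 (vb_morphism_zero (vinvP V)) inv_unit.
have := core_tgt d; rewrite pd map_tgt tgt_unit => -[pK sK].
rewrite -unit_zero -{3}sK mul_unitr.
have -> : mul (unit_ (vb_zero (vb0 V) (map0 f y))) (unit_ (vb_zero (vb0 V) (map0 f y)))
          = vb_zero (vb1 V) (unit_ (map0 f y)).
  by rewrite -{1}(tgt_unit (vb_zero (vb0 V) (map0 f y))) mul_unitl unit_zero.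
by rewrite vb_add0l.
Qed.

End Objectwise.

Lemma nat_iso_homotopic : is_linear_nat_iso F F' (nat_iso_of K) (unit_map0 f) <->
  homotopic_through F F' K.
Proof.
split=> [[_ _ tT nat]|[hom1 hom0]].
  have tK w : tgt (K w) = diff0 F F' w by apply/tgt_nat_iso_ofP.
  split; last by move=> w; rewrite -tK.
  exact/(core_equivariant_homotopic tK)/(natural_core_equivariant tK).
have tK w : tgt (K w) = diff0 F F' w by rewrite hom0.
split.
- exact: nat_iso_of_vb_morphism.
- exact: src_nat_iso_of.
- by move=> w; apply/tgt_nat_iso_ofP.
- by apply/(natural_core_equivariant tK)/(core_equivariant_homotopic tK).
Qed.

Lemma homotopic_fibre_homotopy : homotopic_through F F' K <->
  (forall y, fibre_homotopy F F' K y) /\ core_equivariant F F' K.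
Proof.
split=> [[hom1 hom0]|[fib eqv]].
  have tK w : tgt (K w) = diff0 F F' w by rewrite hom0.
  split; last exact/(core_equivariant_homotopic tK).
  by move=> y; split=> [d|w _]; [exact: homotopic_on_core|exact: tK].
have tK w : tgt (K w) = diff0 F F' w by have [_] := fib (vb_proj (vb0 W) w); exact.
split; last by move=> w; rewrite -tK.
exact/(core_equivariant_homotopic tK).
Qed.

End CoreMorphism.

End HomotopyNaturalIsomorphism.

Theorem theorem2p4p6 (R : realType) (W V : vb_groupoid R)
    (f : lg_morphism (vbase W) (vbase V)) (F F' : vbg_morphism f) :
  (forall T : obj (vtot W) -> arr (vtot V),
     is_vb_morphism (vb0 W) (vb1 V) T (unit_map0 f) ->
     (forall w, src (T w) = map0 F w) ->
     [/\ is_core_morphism (vb0 W) (homotopy_of F T) (map0 f),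
         is_linear_nat_iso F F' T (unit_map0 f) <->
         homotopic_through F F' (homotopy_of F T)
       & homotopic_through F F' (homotopy_of F T) <->
         (forall y, fibre_homotopy F F' (homotopy_of F T) y) /\
         core_equivariant F F' (homotopy_of F T)]) /\
  set_bij [set T | is_linear_nat_iso F F' T (unit_map0 f)]
          [set K | is_core_morphism (vb0 W) K (map0 f) /\
                   homotopic_through F F' K]
          (homotopy_of F).
Proof.
have equiv T : is_vb_morphism (vb0 W) (vb1 V) T (unit_map0 f) ->
    (forall w, src (T w) = map0 F w) ->
    is_core_morphism (vb0 W) (homotopy_of F T) (map0 f) /\
    (is_linear_nat_iso F F' T (unit_map0 f) <->
     homotopic_through F F' (homotopy_of F T)).
  move=> vbT sT; have cT := homotopy_of_core_morphism vbT sT.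
  by split=> //; rewrite -{1}(homotopy_ofK F vbT); exact: nat_iso_homotopic.
split=> [T vbT sT|].
  have [cT natP] := equiv T vbT sT.
  by split=> //; exact: homotopic_fibre_homotopy.
split.
- move=> T natT; have [vbT sT _ _] := natT.
  by have [cT natP] := equiv T vbT sT; split=> //; apply/natP.
- move=> T T' /set_mem[vbT _ _ _] /set_mem[vbT' _ _ _] TT'.
  by rewrite -(homotopy_ofK F vbT) TT' homotopy_ofK.
- move=> K [cK homK]; exists (nat_iso_of F K); last exact: nat_iso_ofK.
  exact/nat_iso_homotopic.
Qed.
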